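(* Let $n\ge 1$. For every partition $\pi=\{B_1,B_2,\ldots,B_k\}$ of $[n]$ (blocks listed in increasing order of their minimal elements) that is atomic and splitable, define $\varphi(\pi)$ as follows: (1) let $i$ be the smallest element of $B_1$ with $i\ge 2$ such that $\pi=\pi_{[i-1]}\circ(\pi_{[i,n]}-i+1)$ (such an $i$ exists because $\pi$ is splitable); (2) let $j$ be the smallest element of the underlying set of the partition $R(\pi_{[i,n]})$; (3) set $\varphi(\pi)=\pi_{[j-1]}\,\big|\,(\pi_{[j,n]}-j+1)$. Then $\varphi$ is a bijection from the set $\mathcal{A}_n\setminus\mathcal{US}_n$ of atomic, splitable partitions of $[n]$ onto the set $\mathcal{US}_n\setminus\mathcal{A}_n$ of unsplitable, non-atomic partitions of $[n]$.
   Context: $[n]=\{1,\ldots,n\}$ and $[a,b]=\{a,a+1,\ldots,b\}$. A partition of a totally ordered finite set $X$ is a family of disjoint nonempty subsets (blocks) with union $X$; blocks are listed in increasing order of their minimal elements. For $S\subseteq X$, the restriction $\pi_S$ is the partition of $S$ obtained from $\pi$ by deleting all elements not in $S$ (two elements of $S$ are in the same block of $\pi_S$ iff they are in the same block of $\pi$). For a partition $\tau$ of a set of integers and an integer $c$, $\tau-c$ (resp. $\tau+c$) denotes the partition obtained by subtracting (resp. adding) $c$ to every element of every block; thus $\pi_{[i,n]}-i+1$ is a partition of $[n-i+1]$. For $\pi=\{B_1,\ldots,B_k\}$ a partition of $[m]$ and $\sigma=\{C_1,\ldots,C_l\}$ a partition of $[n']$ (blocks in standard order), the slash product is $\pi|\sigma=\{B_1,\ldots,B_k,C_1+m,\ldots,C_l+m\}$,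 a partition of $[m+n']$. A partition is atomic if it is not of the form $\sigma|\tau$ with $\sigma,\tau$ nonempty partitions. The split product is $\pi\circ\sigma=\{B_1\cup(C_1+m),\ldots,B_k\cup(C_k+m),C_{k+1}+m,\ldots,C_l+m\}$ if $k\le l$, and $\{B_1\cup(C_1+m),\ldots,B_l\cup(C_l+m),B_{l+1},\ldots,B_k\}$ if $k>l$. A partition is splitable if it equals $\sigma\circ\tau$ for nonempty partitions $\sigma,\tau$, and unsplitable otherwise. $\mathcal{A}_n$ denotes the set of atomic partitions of $[n]$ and $\mathcal{US}_n$ the set of unsplitable partitions of $[n]$. For a partition $\pi=\{B_1,\ldots,B_k\}$ of $X=\{x_1<x_2<\cdots<x_N\}$, let $r$ be the largest index such that $B_r\cup B_{r+1}\cup\cdots\cup B_k=\{x_t,x_{t+1},\ldots,x_N\}$ for some $t$; then $R(\pi)=\{B_r,B_{r+1},\ldots,B_k\}$. *)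

(* Defs.v *)
(* Set partitions of finite sets of naturals are encoded
   canonically as  seq (seq nat): each block is a nonempty strictly
   increasing list, blocks are listed in increasing order of their minima
   (the head of the block), and the concatenation of the blocks is a
   permutation of the (duplicate-free, increasing) ground set. *)
From mathcomp Require Import all_boot.
Set Implicit Arguments. Unset Strict Implicit. Unset Printing Implicit Defensive.

Definition spart := seq (seq nat).

Definition is_part_of (X : seq nat) (p : spart) : Prop :=
  [/\ all (fun b => (b != [::]) && sorted ltn b) p,
      sorted (fun b c => head 0 b < head 0 c) p
    & perm_eq (flatten p) X].

Definition is_setpart (n : nat) (p : spart) : Prop := is_part_of (iota 1 n) p.

Definition segment (a b : nat) : seq nat := iota a (b.+1 - a).

Definition restrict (S : seq nat) (p : spart) : spart :=
  sort (fun b c => head 0 b <= head 0 c)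
    [seq b <- [seq [seq x <- b | x \in S] | b <- p] | b != [::]].

Definition shiftp (c : nat) (p : spart) : spart := [seq [seq x + c | x <- b] | b <- p].
Definition unshiftp (c : nat) (p : spart) : spart := [seq [seq x - c | x <- b] | b <- p].

Definition slash (m : nat) (p q : spart) : spart := p ++ shiftp m q.

Fixpoint zipblocks (p q : spart) : spart :=
  match p, q with
  | b :: p', c :: q' => (b ++ c) :: zipblocks p' q'
  | [::], _ => q
  | _, [::] => p
  end.

Definition splitp (m : nat) (p q : spart) : spart := zipblocks p (shiftp m q).

Definition atomic (n : nat) (p : spart) : Prop :=
  ~ exists m n' s t, [/\ 0 < m, 0 < n', is_setpart m s, is_setpart n' t
                       & p = slash m s t].

Definition splitable (n : nat) (p : spart) : Prop :=
  exists m n' s t, [/\ 0 < m, 0 < n', is_setpart m s, is_setpart n' t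
                     & p = splitp m s t].

(* R(pi): blocks B_r,...,B_k for the largest r such that their union is a
   terminal segment of the ground set (indices here are 0-based). *)
Definition tail_ok (p : spart) (r : nat) : bool :=
  let X := sort leq (flatten p) in
  let U := flatten (drop r p) in
  perm_eq U (drop (size X - size U) X).

Definition Rpart (p : spart) : spart :=
  drop (last 0 [seq r <- iota 0 (size p) | tail_ok p r]) p.

Definition split_at (n : nat) (p : spart) (i : nat) : bool :=
  p == splitp i.-1 (restrict (segment 1 i.-1) p)
                   (unshiftp i.-1 (restrict (segment i n) p)).

Definition phi (n : nat) (p : spart) : spart :=
  let B1 := head [::] p in
  (* smallest i in B1 with i >= 2 satisfying split_at (B1 is increasing) *)
  let i := head 0 [seq x <- B1 | (2 <= x) && split_at n p x] in
  let j := head 0 (sort leq (flatten (Rpart (restrict (segment i n) p)))) in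
  slash j.-1 (restrict (segment 1 j.-1) p)
             (unshiftp j.-1 (restrict (segment j n) p)).

(* Main.v *)
(* A set partition is the same as its restricted growth word, whose i-th letter
   is the (0-based) index of the block of i.  The split product is then
   concatenation of words, and the slash product [u | v] is [u] followed by [v]
   with its letters raised by the number of blocks of [u].  Both products have
   unique factorisation: a nonempty word is uniquely [u ++ x] with [u] nonempty
   unsplitable, and uniquely [x | y] with [y] nonempty atomic.  A splitable word
   is thus [u ++ (x | y)], and phi sends it to [(u ++ x) | y].  Such a word is
   atomic iff [y] is raised in the image by more than in the source, i.e. iff [x]
   has fewer blocks than [u], which is also when [(u ++ x) | y] is unsplitable.
   Injectivity and surjectivity follow by factoring the image [z | y] first
   and then [z = u ++ x]. *)
Require Import Defs.
From mathcomp Require Import all_boot.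
From mathcomp Require Import zify.

Implicit Types (u v w x y a b s t : seq nat) (c k n : nat) (p q : spart).

Lemma size_gt0 (w : seq nat) : (0 < size w) = (w != [::]).
Proof. by case: w. Qed.

(** * Restricted growth words *)

(* Number of blocks: one more than the largest letter, and 0 for the empty word. *)
Definition nb w := foldr (fun d m => maxn d.+1 m) 0 w.

(** Here [k] counts the blocks already open: the next letter names one of them or opens block
    [k]. *)
Fixpoint rgf_from k w :=
  if w is d :: w' then (d <= k) && rgf_from (maxn k d.+1) w' else true.

Definition rgf w := rgf_from 0 w.

Definition wslash u v := u ++ map (addn (nb u)) v.

Lemma nb_cat u v : nb (u ++ v) = maxn (nb u) (nb v).
Proof. by elim: u => [|d u IH] /=; rewrite ?max0n // IH maxnA. Qed.

Lemma nb_shift k v : v != [::] -> nb (map (addn k) v) = k + nb v.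
Proof.
elim: v => [|d [|e v] IH] // _; first by rewrite /= !maxn0 addnS.
by rewrite map_cons /= in IH *; rewrite IH //; lia.
Qed.

Lemma nb_wslash u v : nb (wslash u v) = nb u + nb v.
Proof.
rewrite nb_cat; case: v => [|d v]; first by rewrite /= maxn0 addn0.
by rewrite nb_shift //; lia.
Qed.

Lemma ltn_nb d w : d \in w -> d < nb w.
Proof.
elim: w => [|e w IH] //=; rewrite inE => /orP[/eqP->|/IH]; lia.
Qed.

Lemma nb_leP w k : reflect {in w, forall d, d < k} (nb w <= k).
Proof.
apply: (iffP idP) => [le_k d /ltn_nb lt_d|]; first exact: leq_trans le_k.
elim: w => [|d w IH] //= H; rewrite geq_max H ?mem_head //=.
by apply: IH => e we; apply: H; rewrite inE we orbT.
Qed.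

Lemma nb_gt0 w : w != [::] -> 0 < nb w.
Proof. case: w => //= d w _; lia. Qed.

Lemma rgf_from_cat k u v :
  rgf_from k (u ++ v) = rgf_from k u && rgf_from (maxn k (nb u)) v.
Proof.
elim: u k => [|d u IH] k /=; first by rewrite maxn0.
by rewrite IH andbA maxnA.
Qed.

Lemma rgf_from_leq k k' v : k <= k' -> rgf_from k v -> rgf_from k' v.
Proof.
elim: v k k' => [|d v IH] k k' //= le_k /andP[le_d /(IH _ (maxn k' d.+1)) ->];
  lia.
Qed.

Lemma rgf_from_shift k m v : rgf_from (k + m) (map (addn k) v) = rgf_from m v.
Proof.
elim: v m => [|d v IH] m //=.
by rewrite leq_add2l -addnS -addn_maxr IH.
Qed.

Lemma rgf_prefix u v : rgf (u ++ v) -> rgf u.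
Proof. by rewrite /rgf rgf_from_cat => /andP[]. Qed.

Lemma rgf_cat u v : rgf u -> rgf v -> rgf (u ++ v).
Proof.
rewrite /rgf rgf_from_cat => -> /=; exact: rgf_from_leq.
Qed.

Lemma rgf_wslash u v : rgf (wslash u v) = rgf u && rgf v.
Proof.
by rewrite /rgf rgf_from_cat max0n -{1}(addn0 (nb u)) rgf_from_shift.
Qed.

Lemma rgf_cons0 d w : rgf (d :: w) -> d = 0.
Proof. by rewrite /rgf /= leqn0 => /andP[/eqP]. Qed.

Lemma rgf_mem0 w : rgf w -> w != [::] -> 0 \in w.
Proof. by case: w => // d w /rgf_cons0-> _; rewrite mem_head. Qed.

(** The running bound rises by at most one per letter, so no value from [k] on can be skipped before
    a larger letter appears. *)
Lemma rgf_from_smaller k w i d :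
  rgf_from k w -> i < size w -> k <= d -> d < nth 0 w i -> d \in take i w.
Proof.
elim: w k i => [|e w IH] k [|i] //= /andP[le_e rg_w] lt_i le_d lt_d; first lia.
rewrite inE; case: eqVneq => //= ne_de.
by apply: (IH _ i rg_w) => //; lia.
Qed.

Lemma rgf_smaller w i d :
  rgf w -> i < size w -> d < nth 0 w i -> d \in take i w.
Proof. by move=> rg_w lt_i; apply: rgf_from_smaller rg_w lt_i _. Qed.

Lemma rgf_mem w d : rgf w -> d < nb w -> d \in w.
Proof.
move=> rg_w lt_d; case: (boolP (d \in w)) => // wd'.
suff: nb w <= d by lia.
apply/nb_leP => e we; rewrite ltnNge; apply/negP => le_de.
have ne_de: d != e by apply: contraNneq wd' => ->.
have lt_i: index e w < size w by rewrite index_mem.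
have /(rgf_smaller _ _ _ rg_w lt_i)/mem_take: d < nth 0 w (index e w).
  by rewrite nth_index //; lia.
by rewrite (negPf wd').
Qed.

(** First occurrences are block minima, so this puts the blocks in standard order. *)
Lemma rgf_ltn_index w d e :
  rgf w -> d < e -> e < nb w -> index d w < index e w.
Proof.
move=> rg_w lt_de /(rgf_mem w e rg_w) we.
have lt_i: index e w < size w by rewrite index_mem.
have /(rgf_smaller _ _ _ rg_w lt_i) td: d < nth 0 w (index e w).
  by rewrite nth_index.
exact: index_ltn.
Qed.

(** A criterion free of the running bound, suited to words read off a partition. For the converse, a
    last letter above [nb w] would force [nb w] to occur in [w]. *)
Lemma rgfP w :
  reflect (forall i d, i < size w -> d < nth 0 w i -> d \in take i w) (rgf w).
Proof.
apply: (iffP idP) => [rg_w i d|]; first exact: rgf_smaller.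
elim/last_ind: w => // w d IH H.
rewrite -cats1 /rgf rgf_from_cat max0n /= andbT; apply/andP; split.
  apply: IH => i e lt_i lt_e; have := H i e.
  by rewrite size_rcons nth_rcons lt_i -cats1 takel_cat 1?ltnW // => -> //; lia.
rewrite leqNgt; apply/negP => lt_d; have := H (size w) (nb w).
rewrite size_rcons nth_rcons ltnn eqxx -cats1 take_size_cat //.
by move=> /(_ (leqnn _) lt_d)/ltn_nb; rewrite ltnn.
Qed.

(** * Atomic and splitable words *)

Definition wslashable w :=
  has (fun m => all (leq (nb (take m w))) (drop m w)) (iota 1 (size w).-1).

(** Only the suffix is tested, since a prefix of a restricted growth word is again one. Cuts range
    over [1 .. size w - 1] to keep both factors nonempty. *)
Definition wsplitable w := has (fun m => rgf (drop m w)) (iota 1 (size w).-1).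

Lemma has_cutP (P : seq nat -> seq nat -> bool) w :
  reflect (exists u v, [/\ u != [::], v != [::], w = u ++ v & P u v])
          (has (fun m => P (take m w) (drop m w)) (iota 1 (size w).-1)).
Proof.
apply: (iffP hasP) => [[m]|[u [v [u0 v0 -> Puv]]]].
  rewrite mem_iota => /andP[m_gt0 lt_m] Pm; exists (take m w), (drop m w).
  by rewrite cat_take_drop -!size_gt0 size_take_min size_drop; split=> //; lia.
exists (size u); last by rewrite take_size_cat // drop_size_cat.
by rewrite mem_iota size_cat; rewrite -!size_gt0 in u0 v0; lia.
Qed.

Lemma wsplitableP w :
  reflect (exists u v, [/\ u != [::], v != [::], w = u ++ v & rgf v])
          (wsplitable w).
Proof. exact: (has_cutP (fun _ v => rgf v)). Qed.

Lemma wslashable_catP w :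
  reflect (exists u v, [/\ u != [::], v != [::], w = u ++ v & all (leq (nb u)) v])
          (wslashable w).
Proof. exact: (has_cutP (fun u v => all (leq (nb u)) v)). Qed.

Lemma all_leq_shift k v : all (leq k) v -> v = map (addn k) (map (subn^~ k) v).
Proof.
move=> /allP le_v; rewrite -map_comp -[LHS]map_id; apply/eq_in_map => d /le_v /=.
by move=> /subnKC.
Qed.

Lemma wslashableP w : rgf w ->
  reflect (exists u v, [/\ u != [::], v != [::], rgf u, rgf v & w = wslash u v])
          (wslashable w).
Proof.
move=> rg_w; apply: (iffP (wslashable_catP w)) => -[u [v]].
  case=> u0 v0 Dw le_v; exists u, (map (subn^~ (nb u)) v).
  have Dw': w = wslash u (map (subn^~ (nb u)) v).
    by rewrite Dw {1}(all_leq_shift _ _ le_v).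
  move: (rg_w); rewrite {1}Dw' rgf_wslash => /andP[-> ->]; split=> //.
  by rewrite -size_gt0 size_map size_gt0.
case=> u0 v0 _ _ ->; exists u, (map (addn (nb u)) v); split=> //.
  by rewrite -size_gt0 size_map size_gt0.
by apply/allP => _ /mapP[d _ ->]; rewrite leq_addr.
Qed.

Lemma wslashA u v w : wslash u (wslash v w) = wslash (wslash u v) w.
Proof.
rewrite [RHS]/wslash nb_wslash {1}/wslash {1}/wslash map_cat catA -map_comp.
congr (_ ++ _).
by apply: eq_map => d /=; rewrite addnA.
Qed.

(** Compares two cuts of one word; coinciding cuts fall in the first case, with [t] empty. *)
Lemma cat_eq_cases u v u' v' : u ++ v = u' ++ v' ->
  (exists t, u' = u ++ t /\ v = t ++ v')
  \/ (exists t, [/\ t != [::], u = u' ++ t & v' = t ++ v]).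
Proof.
move=> E; have [le_u|lt_u] := leqP (size u) (size u').
  left; exists (drop (size u) u').
  have Du: u = take (size u) u'.
    have := congr1 (take (size u)) E.
    by rewrite take_size_cat // takel_cat.
  split; first by rewrite {1}Du cat_take_drop.
  have := congr1 (drop (size u)) E; rewrite drop_size_cat // => ->.
  by rewrite drop_cat; case: ltnP => // le_u'; rewrite (drop_oversize le_u') 
     (_ : _ - _ = 0) ?drop0 //; lia.
right; exists (drop (size u') u).
have Du: u' = take (size u') u.
  have := congr1 (take (size u')) E.
  by rewrite (take_size_cat _ (erefl (size u'))) takel_cat // ltnW.
split; first by rewrite -size_gt0 size_drop; lia.
  by rewrite {1}Du cat_take_drop.
have := congr1 (drop (size u')) E.
by rewrite (drop_size_cat _ (erefl (size u'))) drop_cat lt_u.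
Qed.

(** * Existence and uniqueness of the split and slash factorisations *)

(** Strong induction on the size: split [w], factor the shorter left part, and absorb the remainder
    into the right part. *)
Lemma split_factor w : w != [::] -> rgf w ->
  exists u x, [/\ u != [::], rgf u, rgf x, ~~ wsplitable u & w = u ++ x].
Proof.
have [m le_w] := ubnP (size w); elim: m w le_w => // m IH w le_w w0 rg_w.
case: (boolP (wsplitable w)) => [|uns_w]; last first.
  by exists w, [::]; rewrite cats0.
case/wsplitableP=> u [v [u0 v0 Dw rg_v]]; rewrite {w}Dw in le_w w0 rg_w *.
have [|u1 [x [u10 rg_u1 rg_x uns_u1 Du]]] := IH u _ u0 (rgf_prefix _ _ rg_w).
  by rewrite size_cat in le_w; rewrite -size_gt0 in v0; lia.
by exists u1, (x ++ v); rewrite Du catA; split=> //; apply: rgf_cat.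
Qed.

(** If the cuts differ, the longer prefix is the shorter one followed by a nonempty prefix of [x] or
    [x'], a restricted growth word; so the longer prefix splits. *)
Lemma split_factor_uniq u x u' x' :
    u != [::] -> u' != [::] -> rgf x -> rgf x' ->
    ~~ wsplitable u -> ~~ wsplitable u' ->
  u ++ x = u' ++ x' -> u = u' /\ x = x'.
Proof.
move=> u0 u'0 rg_x rg_x' uns_u uns_u' /cat_eq_cases[][[|d t]].
- by rewrite cats0 => -[-> ->].
- case=> Du' Dx; case/wsplitableP: uns_u'; exists u, (d :: t); split=> //.
  by move: rg_x; rewrite Dx => /rgf_prefix.
- by case.
case=> _ Du Dx; case/wsplitableP: uns_u; exists u', (d :: t); split=> //.
by move: rg_x'; rewrite Dx => /rgf_prefix.
Qed.

(** Dual to the split case: the right factor is factored further, and associativity of the slash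
    product regroups the left ones. *)
Lemma slash_factor w : w != [::] -> rgf w ->
  exists x y, [/\ y != [::], rgf x, rgf y, ~~ wslashable y & w = wslash x y].
Proof.
have [m le_w] := ubnP (size w); elim: m w le_w => // m IH w le_w w0 rg_w.
case: (boolP (wslashable w)) => [|at_w]; last first.
  by exists [::], w; rewrite /wslash map_id.
case/(wslashableP _ rg_w)=> u [v [u0 v0 rg_u rg_v Dw]].
have [|x [y [y0 rg_x rg_y at_y Dv]]] := IH v _ v0 rg_v.
  move: le_w; rewrite Dw size_cat size_map; rewrite -size_gt0 in u0; lia.
by exists (wslash u x), y; rewrite Dw Dv wslashA rgf_wslash rg_u rg_x.
Qed.

Lemma map_eq_cat (f : nat -> nat) (r t1 t2 : seq nat) :
  map f r = t1 ++ t2 -> exists r1 r2, [/\ r = r1 ++ r2, t1 = map f r1 & t2 = map f r2].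
Proof.
move=> E; exists (take (size t1) r), (drop (size t1) r).
by rewrite cat_take_drop map_take map_drop E take_size_cat // drop_size_cat.
Qed.

(** The key to uniqueness, to atomicity and to computing R: a cut at a level [k] above [nb x] must
    fall strictly inside [y]. A cut inside [x] would put a letter below [nb x] into [b]. After
    lowering by [nb x], the cut slashes [y]. *)
Lemma slash_later_cut x y a b k :
    y != [::] -> rgf y -> b != [::] -> nb x < k -> nb a <= k -> all (leq k) b ->
  wslash x y = a ++ b -> wslashable y.
Proof.
move=> y0 rg_y b0 lt_k le_a /allP ge_b.
case/cat_eq_cases=> [[s [Da Ds]]|[t [t0 Dx Db]]]; last first.
  case: t t0 Dx Db => // d t _ Dx Db.
  have: d < nb x by rewrite Dx nb_cat; have /= := leq_maxr (nb a) (nb (d :: t)); lia.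
  have: k <= d by apply: ge_b; rewrite Db mem_head.
  lia.
have [s1 [b1 [Dy Ds1 Db1]]] := map_eq_cat _ _ _ _ Ds.
apply/wslashable_catP; exists s1, b1; split=> //.
(* If the cut came right after [x], the letter 0 of [y] would give [b] the letter [nb x], which is
   below [k]. *)
- apply: contraNneq b0 => s10; have := rgf_mem0 _ rg_y y0.
  rewrite Dy s10 /= => /(map_f (addn (nb x))); rewrite -Db1 addn0 => /ge_b.
  lia.
- by apply: contraNneq b0 => b10; rewrite Db1 b10.
apply/allP=> d /(map_f (addn (nb x))); rewrite -Db1 => /ge_b.
(* The empty word is set apart because raising it leaves [nb] at 0. *)
have: s1 = [::] \/ nb x + nb s1 <= k.
  case: (eqVneq s1 [::]) => [|s10]; [by left | right].
  by rewrite -nb_shift // -Ds1; apply: leq_trans le_a; rewrite Da nb_cat leq_maxr.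
by case=> [->//|]; lia.
Qed.

(** Suppose [x'] is [x ++ t]. If it had more blocks than [x], its cut would slash [y]. So [t] opens
    no new block; but a first letter of [t] belongs to the raised [y] and is at least [nb x]. Hence
    [t] is empty. *)
Lemma slash_factor_uniq x y x' y' :
    y != [::] -> y' != [::] -> rgf y -> rgf y' ->
    ~~ wslashable y -> ~~ wslashable y' ->
  wslash x y = wslash x' y' -> x = x' /\ y = y'.
Proof.
have shift_le z k : all (leq k) (map (addn k) z).
  by apply/allP => _ /mapP[d _ ->]; rewrite leq_addr.
have nil_shift z k : z != [::] -> map (addn k) z != [::].
  by rewrite -!size_gt0 size_map.
have le_nb z t v v' : v != [::] -> v' != [::] -> rgf v -> rgf v' -> ~~ wslashable v ->
   wslash z v = wslash (z ++ t) v' -> nb (z ++ t) <= nb z.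
  move=> v0 v'0 rg_v rg_v' at_v E; rewrite leqNgt; apply: contra at_v => lt_z.
  exact: slash_later_cut v0 rg_v (nil_shift v' _ v'0) lt_z (leqnn _) (shift_le _ _) E.
have nil_t z t v v' : v != [::] -> v' != [::] -> rgf v -> rgf v' -> ~~ wslashable v ->
   wslash z v = wslash (z ++ t) v' -> t = [::].
  move=> v0 v'0 rg_v rg_v' at_v E; have le_z := le_nb _ _ _ _ v0 v'0 rg_v rg_v' at_v E.
  case: t E le_z => // d t; rewrite /wslash -catA => /eqP.
  rewrite eqseq_cat // eqxx /= => /eqP Dt.
  have: nb z <= d.
    by have /allP->// := shift_le v (nb z); rewrite Dt mem_head.
  by rewrite nb_cat /=; lia.
have tail_eq z v v' : wslash z v = wslash z v' -> v = v'.
  by move/eqP; rewrite eqseq_cat // eqxx => /eqP/(inj_map (@addnI _)).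
move=> y0 y'0 rg_y rg_y' at_y at_y' E.
case/cat_eq_cases: (E) => [[t [Dx' _]]|[t [_ Dx _]]].
  rewrite Dx' in E; have t0 := nil_t _ _ _ _ y0 y'0 rg_y rg_y' at_y E.
  rewrite Dx' t0 cats0; rewrite t0 cats0 in E.
  by split=> //; apply: tail_eq E.
rewrite Dx in E; have t0 := nil_t _ _ _ _ y'0 y0 rg_y' rg_y at_y' (esym E).
rewrite Dx t0 cats0; rewrite t0 cats0 in E.
by split=> //; apply: tail_eq E.
Qed.

(** * Exchanging the two products: the condition [nb x < nb u] *)

(** If [nb u <= nb x], then [u ++ x] has as many blocks as [x], so [y] is raised equally in both
    words and [u ++ (x | y)] equals [(u ++ x) | y]. *)
Lemma nb_lt_of_atomic u x y :
    u != [::] -> rgf u -> rgf x -> rgf y -> y != [::] ->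
  ~~ wslashable (u ++ wslash x y) -> nb x < nb u.
Proof.
move=> u0 rg_u rg_x rg_y y0; rewrite ltnNge; apply: contra => le_u.
have Dw: u ++ wslash x y = wslash (u ++ x) y.
  by rewrite /wslash nb_cat (maxn_idPr le_u) catA.
rewrite Dw; apply/wslashableP; first by rewrite rgf_wslash rgf_cat.
by exists (u ++ x), y; split; rewrite ?rgf_cat //; case: (u) u0.
Qed.

(** A splitting suffix cannot start in [u], which would split; nor in [y], whose raised letters miss
    0; nor in [x], because there at most [nb x] blocks are open when [y] begins with the letter
    [nb u]. *)
Lemma wslash_unsplitable u x y :
    y != [::] -> rgf y -> ~~ wsplitable u -> nb x < nb u ->
  ~~ wsplitable (wslash (u ++ x) y).
Proof.
move=> y0 rg_y uns_u lt_x; apply/negP => /wsplitableP[a [b [a0 b0]]].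
have -> : wslash (u ++ x) y = u ++ (x ++ map (addn (nb u)) y).
  by rewrite /wslash nb_cat (maxn_idPl _) ?catA // ltnW.
have u_gt0: 0 < nb u by apply: leq_ltn_trans (leq0n _) _; eassumption.
case/cat_eq_cases=> [[s [_ Db]]|[t [t0 Du ->]] /rgf_prefix rg_t]; last first.
  by case/negP: uns_u; apply/wsplitableP; exists a, t.
case/cat_eq_cases: Db => [[t [_ Dy]]|[t [t0 Dx ->]]] rg_b.
  have := rgf_mem0 _ rg_b b0; have: {subset b <= map (addn (nb u)) y}.
    by move=> d bd; rewrite Dy mem_cat bd orbT.
  by move=> sub_b /sub_b/mapP[d _]; lia.
have: nb t <= nb x by rewrite Dx nb_cat leq_maxr.
case: y y0 rg_y rg_b => // d y _ /rgf_cons0->.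
rewrite /rgf rgf_from_cat /= => /and3P[_ + _]; lia.
Qed.

(** A slash cut inside [u] leaves the letter 0 of [x | y] on its right, which is too small. A later
    cut has level at least [nb u], above [nb x], and so slashes [y]. *)
Lemma unslash_atomic u x y :
    u != [::] -> rgf u -> rgf x -> rgf y -> y != [::] ->
    ~~ wslashable y -> nb x < nb u ->
  ~~ wslashable (u ++ wslash x y).
Proof.
move=> u0 rg_u rg_x rg_y y0 at_y lt_x; apply/negP => /wslashable_catP[a [b]].
case=> a0 b0 Dw ge_b; case/negP: at_y.
have a_gt0 := nb_gt0 _ a0.
case/cat_eq_cases: Dw => [[s [Da Ds]]|[t [_ _ Db]]].
  have le_a: nb u <= nb a by rewrite Da nb_cat leq_maxl.
  apply: slash_later_cut y0 rg_y b0 (leq_trans lt_x le_a) _ ge_b Ds.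
  by rewrite Da nb_cat leq_maxr.
have xy0: wslash x y != [::] by case: (x) => //; case: (y) y0.
have: 0 \in b.
  by rewrite Db mem_cat (rgf_mem0 (wslash x y)) ?orbT // rgf_wslash rg_x.
by move/(allP ge_b); lia.
Qed.

(** The same coincidence of the two words when [nb u <= nb x], read now as a splitting. *)
Lemma nb_lt_of_unsplitable u x y :
    u != [::] -> rgf x -> rgf y -> y != [::] ->
  ~~ wsplitable (wslash (u ++ x) y) -> nb x < nb u.
Proof.
move=> u0 rg_x rg_y y0; rewrite ltnNge; apply: contra => le_u.
have -> : wslash (u ++ x) y = u ++ wslash x y.
  by rewrite /wslash nb_cat (maxn_idPr le_u) catA.
apply/wsplitableP; exists u, (wslash x y).
by rewrite rgf_wslash rg_x rg_y; split=> //; case: (x) => //; case: (y) y0.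
Qed.

(** * Set partitions as restricted growth words *)

(* The ground set is [c, c + 1, ...], so that terminal segments need no renumbering. *)
Definition cls c w d := [seq i <- iota c (size w) | nth 0 w (i - c) == d].

Definition blocks c w : spart := [seq cls c w d | d <- iota 0 (nb w)].

Definition word c p := [seq find (fun B => i \in B) p | i <- iota c (size (flatten p))].

Lemma mem_cls c w d i :
  (i \in cls c w d) = (c <= i < c + size w) && (nth 0 w (i - c) == d).
Proof. by rewrite mem_filter mem_iota andbC. Qed.

Lemma cls_sorted c w d : sorted ltn (cls c w d).
Proof. exact/(sorted_filter ltn_trans)/iota_ltn_sorted. Qed.

Lemma cls_cat c u v d : cls c (u ++ v) d = cls c u d ++ cls (c + size u) v d.
Proof.
rewrite /cls size_cat iotaD filter_cat; congr (_ ++ _); apply: eq_in_filter => i;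
  rewrite mem_iota nth_cat => lt_i; first by rewrite (_ : _ < _ = true) //; lia.
by rewrite (_ : _ < _ = false) ?subnDA //; lia.
Qed.

Lemma cls_cons c e w d :
  cls c (e :: w) d = (if e == d then [:: c] else [::]) ++ cls c.+1 w d.
Proof. by rewrite -cat1s cls_cat addn1 {1}/cls /= subnn. Qed.

Lemma cls_notin c w d : d \notin w -> cls c w d = [::].
Proof.
elim: w c => [|e w IH] c //; rewrite inE negb_or cls_cons eq_sym => /andP[].
by move=> /negPf-> /IH->.
Qed.

Lemma cls_nil c w d : (cls c w d == [::]) = (d \notin w).
Proof.
elim: w c => [|e w IH] c //; rewrite inE cls_cons (eq_sym e).
by case: (d =P e) => //= _; rewrite IH.
Qed.

Lemma cls_out c w d : nb w <= d -> cls c w d = [::].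
Proof.
by move=> le_d; apply: cls_notin; apply/negP => /ltn_nb; rewrite ltnNge le_d.
Qed.

Lemma head_cls c w d : d \in w -> head 0 (cls c w d) = c + index d w.
Proof.
elim: w c => [|e w IH] c //; rewrite inE cls_cons (eq_sym e) /= (eq_sym e).
by case: (d =P e) => [_|ne] /=; rewrite ?addn0 // => /IH->; rewrite addSnnS.
Qed.

Lemma cls_shift c k w d : [seq i + k | i <- cls c w d] = cls (c + k) w d.
Proof.
rewrite /cls addnC iotaDl filter_map; under eq_map do rewrite addnC.
by congr map; apply: eq_filter => i /=; rewrite subnDl.
Qed.

Lemma cls_map_addn c k v d : cls c (map (addn k) v) (k + d) = cls c v d.
Proof.
rewrite /cls size_map; apply: eq_in_filter => i; rewrite mem_iota => lt_i.
by rewrite (nth_map 0) ?eqn_add2l //; lia.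
Qed.

Lemma cls_map_addn_lt c k v d : d < k -> cls c (map (addn k) v) d = [::].
Proof. by move=> lt_d; apply: cls_notin; apply/mapP => -[e _]; lia. Qed.

(** * Shifts and products of block lists *)

Lemma shiftp_blocks c k w : shiftp k (blocks c w) = blocks (c + k) w.
Proof. by rewrite /shiftp -map_comp; apply: eq_map => d /=; apply: cls_shift. Qed.

Lemma shiftpK k p : unshiftp k (shiftp k p) = p.
Proof.
by rewrite /unshiftp /shiftp -map_comp; apply: map_id_in => B _ /=;
  rewrite -map_comp map_id_in // => i _ /=; rewrite addnK.
Qed.

Lemma unshiftp_blocks c k w : unshiftp k (blocks (c + k) w) = blocks c w.
Proof. by rewrite -shiftp_blocks shiftpK. Qed.

Lemma blocks_wslash c u v :
  blocks c (wslash u v) = blocks c u ++ blocks (c + size u) v.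
Proof.
rewrite /blocks nb_wslash iotaD map_cat add0n; congr (_ ++ _).
  apply/eq_in_map => d; rewrite mem_iota => lt_d.
  by rewrite cls_cat cls_map_addn_lt ?cats0.
rewrite -{1}[nb u]addn0 iotaDl -map_comp; apply: eq_map => d /=.
by rewrite cls_cat cls_out ?leq_addr // cls_map_addn.
Qed.

(** Blocks left over in the longer list are blocks concatenated with an empty one, so zipping
    becomes pointwise concatenation. *)
Lemma zipblocks_iota (f g : nat -> seq nat) m k l :
    (forall d, m + k <= d -> f d = [::]) -> (forall d, m + l <= d -> g d = [::]) ->
  zipblocks [seq f d | d <- iota m k] [seq g d | d <- iota m l] =
  [seq f d ++ g d | d <- iota m (maxn k l)].
Proof.
elim: k m l => [|k IH] m [|l] f0 g0; rewrite ?max0n ?maxn0 ?maxnSS //=.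
- by congr (_ :: _); rewrite ?f0 ?addn0 //; apply/eq_in_map => d;
    rewrite mem_iota => lt_d; rewrite f0 //; lia.
- by rewrite g0 ?addn0 // cats0; congr (_ :: _); apply/eq_in_map => d;
    rewrite mem_iota => lt_d; rewrite g0 ?cats0 //; lia.
by rewrite IH // => d le_d; [apply: f0 | apply: g0]; lia.
Qed.

Lemma zipblocks_blocks c u v :
  zipblocks (blocks c u) (blocks (c + size u) v) = blocks c (u ++ v).
Proof.
rewrite /blocks zipblocks_iota ?nb_cat => [|d|d]; try exact: cls_out.
by apply: eq_map => d; rewrite cls_cat.
Qed.

Lemma perm_flatten_cls c w (D : seq nat) : uniq D -> {subset w <= D} ->
  perm_eq (flatten [seq cls c w d | d <- D]) (iota c (size w)).
Proof.
move=> uD sub_w; apply: uniq_perm; rewrite ?iota_uniq //.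
  elim: D uD {sub_w} => //= d D IH /andP[dD' /IH uD].
  rewrite cat_uniq uD andbT (sorted_uniq ltn_trans ltnn) ?cls_sorted //=.
  apply/hasPn => i /flatten_mapP[e eD]; rewrite !mem_cls => /andP[-> /eqP->].
  by apply: contraNneq dD' => <-.
move=> i; apply/flatten_mapP/idP => [[d _]|].
  by rewrite mem_cls mem_iota => /andP[].
rewrite mem_iota => lt_i; exists (nth 0 w (i - c)).
  by have /(mem_nth 0)/sub_w: i - c < size w by lia.
by rewrite mem_cls lt_i eqxx.
Qed.

Lemma perm_flatten_blocks c w : perm_eq (flatten (blocks c w)) (iota c (size w)).
Proof.
by apply: perm_flatten_cls; rewrite ?iota_uniq // => d /ltn_nb; rewrite mem_iota.
Qed.

(** Restricted growth enters twice: every letter below [nb w] occurs, so no block is empty, and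
    first occurrences increase, so the minima do. *)
Lemma blocks_part c w : rgf w -> is_part_of (iota c (size w)) (blocks c w).
Proof.
move=> rg_w; split; last exact: perm_flatten_blocks.
  apply/allP => _ /mapP[d lt_d ->]; rewrite cls_sorted andbT cls_nil negbK.
  by apply: rgf_mem => //; rewrite mem_iota in lt_d.
rewrite sorted_map; apply: (@sub_in_sorted _ [pred d | d < nb w] ltn);
  [|by apply/allP => d; rewrite mem_iota|exact: iota_ltn_sorted].
move=> d e; rewrite !inE => lt_d lt_e lt_de /=.
by rewrite !head_cls ?rgf_mem // ltn_add2l rgf_ltn_index.
Qed.

Lemma blocksK c : cancel (blocks c) (word c).
Proof.
move=> w; rewrite /word (perm_size (perm_flatten_blocks c w)) size_iota.
apply: (@eq_from_nth _ 0); rewrite size_map size_iota // => k lt_k.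
rewrite (nth_map 0) ?size_iota // nth_iota //.
have lt_wk: nth 0 w k < nb w by apply/ltn_nb/mem_nth.
have Dmem d : (c + k \in cls c w d) = (nth 0 w k == d).
  by rewrite mem_cls leq_addr ltn_add2l lt_k addKn.
rewrite /blocks find_map (eq_find (a2 := pred1 (nth 0 w k))) => [|d /=].
  have := @index_uniq _ 0 (nth 0 w k) _ _ (iota_uniq 0 (nb w)).
  by rewrite size_iota nth_iota // add0n => /(_ lt_wk).
by rewrite Dmem eq_sym.
Qed.

(** * Every set partition comes from a restricted growth word *)

Lemma mem_nth_flatten i d p : i \in nth [::] p d -> i \in flatten p.
Proof.
move=> id; apply/flattenP; exists (nth [::] p d) => //.
by apply: mem_nth; case: ltnP => // le_d; rewrite nth_default in id.
Qed.

Lemma uniq_flatten_nth i d e p :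
  uniq (flatten p) -> i \in nth [::] p d -> i \in nth [::] p e -> d = e.
Proof.
elim: p d e => [|B p IH] [|d] [|e] //=; rewrite cat_uniq => /and3P[_ /hasPn H u_p].
- by move=> iB /mem_nth_flatten/H; rewrite /= iB.
- by move=> /mem_nth_flatten/H /= /negPf->.
by move=> id ie; congr _.+1; apply: IH u_p id ie.
Qed.

Lemma sorted_head_leq (B : seq nat) i : sorted ltn B -> i \in B -> head 0 B <= i.
Proof.
case: B => // j B /= sB; rewrite inE => /orP[/eqP-> //|iB].
exact/ltnW/(allP (order_path_min ltn_trans sB)).
Qed.

Lemma head_mem (B : seq nat) : B != [::] -> head 0 B \in B.
Proof. by case: B => // i B _; rewrite mem_head. Qed.

(** The word sends each element to the index of its block, which is unique by disjointness. *)
Lemma blocks_of_part c n p : is_part_of (iota c n) p ->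
  exists w, [/\ rgf w, size w = n & p = blocks c w].
Proof.
case=> /allP p_blocks p_heads p_perm.
have u_p : uniq (flatten p) by rewrite (perm_uniq p_perm) iota_uniq.
have mem_p := perm_mem p_perm.
have sz_p : size (flatten p) = n by rewrite (perm_size p_perm) size_iota.
pose f i := find (fun B : seq nat => i \in B) p.
have find_mem i : i \in flatten p -> i \in nth [::] p (f i).
  case/flattenP=> B pB iB; apply: (@nth_find _ [::] (fun C : seq nat => i \in C)).
  by apply/hasP; exists B.
have f_mem i d : i \in nth [::] p d -> f i = d.
  by move=> id; have /find_mem := mem_nth_flatten _ _ _ id; move/uniq_flatten_nth; apply.
have mem_f i : i \in iota c n -> i \in nth [::] p (f i).
  by rewrite -mem_p => /find_mem.
set w := word c p; have sz_w : size w = n by rewrite size_map size_iota.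
have nth_w j : j < n -> nth 0 w j = f (c + j).
  by move=> lt_j; rewrite (nth_map 0) ?size_iota ?sz_p // nth_iota.
have Dcls d i : (i \in cls c w d) = (i \in nth [::] p d).
  rewrite mem_cls sz_w; apply/andP/idP => [[lt_i /eqP<-]|id].
    by rewrite nth_w ?subnKC; [apply: mem_f; rewrite mem_iota | lia..].
  have lt_i : c <= i < c + n by rewrite -mem_iota -mem_p (mem_nth_flatten _ d).
  by rewrite nth_w ?subnKC; [rewrite (f_mem _ _ id) | lia..].
have nth_block d : d < size p -> nth [::] p d != [::] /\ sorted ltn (nth [::] p d).
  by move=> lt_d; apply/andP/p_blocks/mem_nth.
have head_pos d : d < size p -> exists2 j, j < n & head 0 (nth [::] p d) = c + j /\ nth 0 w j = d.
  case/nth_block=> /head_mem; set i := head _ _ => id _.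
  have: i \in iota c n by rewrite -mem_p (mem_nth_flatten _ d).
  rewrite mem_iota => lt_i; exists (i - c); first by lia.
  by rewrite nth_w ?subnKC ?(f_mem _ _ id); lia.
have lt_size e : e \in w -> e < size p.
  case/(nthP 0)=> j; rewrite sz_w => lt_j <-; rewrite nth_w //.
  have: c + j \in iota c n by rewrite mem_iota; lia.
  by move/mem_f; case: ltnP => // le_p; rewrite nth_default.
have nb_w : nb w = size p.
  apply/eqP; rewrite eqn_leq; apply/andP; split; first exact/nb_leP/lt_size.
  rewrite leqNgt; apply/negP => /head_pos[j lt_j [_ Dj]].
  have /ltn_nb: nth 0 w j \in w by rewrite mem_nth ?sz_w.
  by rewrite Dj ltnn.
exists w; split=> //.
  (* The minimum of block [d] precedes that of block [e], hence the element at position [j]; its own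
     position [j'] carries the letter [d]. *)
  apply/rgfP => j d; rewrite sz_w => lt_j; set e := nth 0 w j => lt_d.
  have lt_e : e < size p by apply: lt_size; rewrite mem_nth ?sz_w.
  have [j' lt_j' [Dj' <-]] := head_pos d (ltn_trans lt_d lt_e).
  have [_ sorted_e] := nth_block e lt_e.
  have le_e : head 0 (nth [::] p e) <= c + j.
    apply: sorted_head_leq => //.
    by rewrite -Dcls mem_cls sz_w leq_addr ltn_add2l lt_j addKn eqxx.
  have := sorted_ltn_nth (fun y x z => @ltn_trans (head 0 y) (head 0 x) (head 0 z))
    [::] p_heads d e (ltn_trans lt_d lt_e) lt_e lt_d.
  rewrite /= Dj' => lt_h.
  have lt_jj : j' < j by lia.
  by rewrite -(nth_take 0 lt_jj) mem_nth // size_takel ?sz_w // ltnW.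
apply: (@eq_from_nth _ [::]) => [|d lt_d]; first by rewrite size_map size_iota nb_w.
rewrite (nth_map 0) ?size_iota ?nb_w // nth_iota ?nb_w //.
apply: (irr_sorted_eq ltn_trans ltnn) => [||i]; last by rewrite Dcls.
  by case: (nth_block d lt_d).
exact: cls_sorted.
Qed.

(** * Restriction of partitions *)

Lemma uniq_heads p : all (fun B => B != [::]) p -> uniq (flatten p) ->
  uniq (map (head 0) p).
Proof.
elim: p => //= B p IH /andP[B0 p0]; rewrite cat_uniq => /and3P[_ /hasPn H u_p].
rewrite IH // andbT; apply/mapP => -[C pC E].
have /H/negP[] : head 0 B \in flatten p; last exact: head_mem.
by apply/flattenP; exists C => //; rewrite E head_mem // (allP p0).
Qed.

Lemma restrict_part X S p : uniq X -> is_part_of X p ->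
  is_part_of [seq i <- X | i \in S] (restrict S p).
Proof.
move=> uX [/allP p_blocks _ p_perm].
pose le_head (B C : seq nat) := head 0 B <= head 0 C.
pose q := [seq B <- [seq [seq i <- B | i \in S] | B <- p] | B != [::]].
rewrite -[restrict S p]/(sort le_head q).
have perm_q : perm_eq (sort le_head q) q by rewrite perm_sort.
have flat_q : flatten q = [seq i <- flatten p | i \in S].
  rewrite /q filter_flatten; elim: (map _ p) => //= B r IH.
  by case: eqP => [->|_] /=; rewrite IH.
have flat : perm_eq (flatten (sort le_head q)) [seq i <- X | i \in S].
  by rewrite (perm_trans (perm_flatten perm_q)) // flat_q perm_filter.
have blocks_q : all (fun B => (B != [::]) && sorted ltn B) (sort le_head q).
  rewrite all_sort; apply/allP => B; rewrite mem_filter => /andP[-> /mapP[C pC ->]] /=.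
  by apply/(sorted_filter ltn_trans); case/andP: (p_blocks C pC).
split=> //; suff: sorted ltn (map (head 0) (sort le_head q)) by rewrite sorted_map.
(* Sorting orders the minima weakly; disjointness of the blocks makes the order strict. *)
rewrite ltn_sorted_uniq_leq uniq_heads.
- by rewrite sorted_map; apply: sort_sorted => B C; apply: leq_total.
- by apply: sub_all blocks_q => B /andP[].
by rewrite (perm_uniq flat) filter_uniq.
Qed.

Lemma restrict_eq X S p q : is_part_of X q ->
  [seq B <- [seq [seq i <- B | i \in S] | B <- p] | B != [::]] = q ->
  restrict S p = q.
Proof.
move=> [_ heads_q _] Dq; rewrite /restrict Dq sorted_sort //.
  by move=> B C D; apply: leq_trans.
by apply: sub_sorted heads_q => B C; apply: ltnW.
Qed.

(** For the restrictions below, the blocks that survive are those with indices in one interval. *)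
Lemma filter_nonnil_iota (f : nat -> seq nat) N m k : m + k <= N ->
    (forall d, d < N -> (f d != [::]) = (m <= d < m + k)) ->
  [seq B <- [seq f d | d <- iota 0 N] | B != [::]] = [seq f d | d <- iota m k].
Proof.
move=> le_N f0; rewrite filter_map; congr map.
apply: (irr_sorted_eq ltn_trans ltnn).
- exact/(sorted_filter ltn_trans)/iota_ltn_sorted.
- exact: iota_ltn_sorted.
move=> d; rewrite mem_filter !mem_iota /= add0n.
case: ltnP => [/f0->|le_d]; rewrite ?andbT ?andbF //; lia.
Qed.

Lemma restrict_blocks_prefix c u t : rgf u ->
  restrict (iota c (size u)) (blocks c (u ++ t)) = blocks c u.
Proof.
move=> rg_u; apply: (restrict_eq _ _ _ _ (blocks_part c u rg_u)).
rewrite -map_comp (eq_map (g := cls c u)) => [|d /=]; last first.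
  rewrite cls_cat filter_cat (all_filterP _); last first.
    by apply/allP => i; rewrite mem_cls mem_iota => /andP[].
  rewrite (eq_in_filter (a2 := pred0)) ?filter_pred0 ?cats0 // => i.
  by rewrite mem_cls mem_iota /= => /andP[lt_i _]; lia.
apply: filter_nonnil_iota => [|d _]; first by rewrite nb_cat leq_maxl.
rewrite cls_nil negbK; apply/idP/idP => [/ltn_nb //|]; exact: rgf_mem.
Qed.

(** The offset [k] covers both uses: 0 for the right factor of a split, [nb x] for the final [y] of
    [u ++ (x | y)]. *)
Lemma restrict_blocks_suffix c k u v : rgf v -> v != [::] ->
  restrict (iota (c + size u) (size v)) (blocks c (u ++ map (addn k) v)) =
  blocks (c + size u) v.
Proof.
move=> rg_v v0; apply: (restrict_eq _ _ _ _ (blocks_part _ v rg_v)).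
rewrite -map_comp (eq_map (g := cls (c + size u) (map (addn k) v))) => [|d /=]; last first.
  rewrite cls_cat filter_cat (all_filterP (s := cls (c + size u) _ _) _); last first.
    by apply/allP => i; rewrite mem_cls mem_iota size_map => /andP[].
  rewrite (eq_in_filter (a2 := pred0)) ?filter_pred0 // => i.
  by rewrite mem_cls mem_iota /= => /andP[lt_i _]; lia.
rewrite (filter_nonnil_iota _ _ k (nb v)).
- have -> : iota k (nb v) = map (addn k) (iota 0 (nb v)) by rewrite -iotaDl addn0.
  by rewrite -map_comp; apply: eq_map => d; apply: cls_map_addn.
- by rewrite nb_cat nb_shift // leq_maxr.
move=> d _; rewrite cls_nil negbK; apply/mapP/idP => [[e /ltn_nb lt_e ->]|lt_d].
  by rewrite leq_addr ltn_add2l.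
by exists (d - k); [apply: rgf_mem => // | ]; lia.
Qed.

(** * Products, atomicity and splitability of partitions, read on words *)

Lemma slash_blocks u v : slash (size u) (blocks 1 u) (blocks 1 v) = blocks 1 (wslash u v).
Proof. by rewrite /slash shiftp_blocks blocks_wslash. Qed.

Lemma splitp_blocks u v : splitp (size u) (blocks 1 u) (blocks 1 v) = blocks 1 (u ++ v).
Proof. by rewrite /splitp shiftp_blocks zipblocks_blocks. Qed.

Lemma blocks_inj c : injective (blocks c).
Proof. exact: can_inj (blocksK c). Qed.

Lemma atomic_blocks n w : rgf w -> atomic n (blocks 1 w) <-> ~~ wslashable w.
Proof.
move=> rg_w; split=> [at_w|/negP at_w [m [n' [s [t [m0 n0]]]]]].
  apply/negP => /(wslashableP _ rg_w)[u [v [u0 v0 rg_u rg_v Dw]]]; apply: at_w.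
  exists (size u), (size v), (blocks 1 u), (blocks 1 v).
  by rewrite !size_gt0 slash_blocks Dw; split=> //; apply: blocks_part.
move=> /blocks_of_part[u [rg_u sz_u ->]] /blocks_of_part[v [rg_v sz_v ->]].
rewrite -sz_u slash_blocks => /blocks_inj Dw; apply/at_w/(wslashableP _ rg_w).
by exists u, v; rewrite -!size_gt0 sz_u sz_v.
Qed.

Lemma splitable_blocks n w : rgf w -> splitable n (blocks 1 w) <-> wsplitable w.
Proof.
move=> rg_w; split=> [[m [n' [s [t [m0 n0]]]]]|].
  move=> /blocks_of_part[u [rg_u sz_u ->]] /blocks_of_part[v [rg_v sz_v ->]].
  rewrite -sz_u splitp_blocks => /blocks_inj Dw; apply/wsplitableP.
  by exists u, v; rewrite -!size_gt0 sz_u sz_v.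
case/wsplitableP=> u [v [u0 v0 Dw rg_v]].
exists (size u), (size v), (blocks 1 u), (blocks 1 v).
rewrite !size_gt0 splitp_blocks Dw; split=> //; apply: blocks_part => //.
by move: rg_w; rewrite Dw => /rgf_prefix.
Qed.

(** * The map phi on words *)

Lemma segment1 m : segment 1 m = iota 1 m.
Proof. by rewrite /segment subn1. Qed.

Lemma segmentS m k : segment m.+1 (m + k) = iota m.+1 k.
Proof. by rewrite /segment subSS addKn. Qed.

(** Restricting to the suffix renumbers its blocks into some restricted growth word [v']; the split
    product gives back the partition only if [v'] is [v]. *)
Lemma split_at_blocks u v : rgf (u ++ v) -> v != [::] ->
  split_at (size (u ++ v)) (blocks 1 (u ++ v)) (size u).+1 = rgf v.
Proof.
move=> rg_uv v0; have rg_u := rgf_prefix _ _ rg_uv.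
rewrite /split_at size_cat segment1 segmentS /= restrict_blocks_prefix //.
apply/eqP/idP => [E|rg_v]; last first.
  have := restrict_blocks_suffix 1 0 u v rg_v v0; rewrite map_id => ->.
  by rewrite unshiftp_blocks splitp_blocks.
have /restrict_part := blocks_part 1 _ rg_uv.
move/(_ (iota (size u).+1 (size v)) (iota_uniq _ _)).
have -> : [seq i <- iota 1 (size (u ++ v)) | i \in iota (size u).+1 (size v)]
          = iota (1 + size u) (size v).
  apply: (irr_sorted_eq ltn_trans ltnn).
  - exact/(sorted_filter ltn_trans)/iota_ltn_sorted.
  - exact: iota_ltn_sorted.
  by move=> i; rewrite mem_filter !mem_iota size_cat; lia.
case/blocks_of_part=> v' [rg_v' _ Dr].
move: E; rewrite Dr unshiftp_blocks splitp_blocks => /blocks_inj/eqP.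
by rewrite eqseq_cat // eqxx => /eqP->.
Qed.

Lemma sort_flatten_blocks c w : sort leq (flatten (blocks c w)) = iota c (size w).
Proof.
apply: (sorted_eq leq_trans anti_leq); rewrite ?iota_sorted ?sort_sorted //.
  exact: leq_total.
by rewrite perm_sort perm_flatten_blocks.
Qed.

Lemma mem_flatten_drop_blocks c w r i :
  (i \in flatten (drop r (blocks c w))) = (c <= i < c + size w) && (r <= nth 0 w (i - c)).
Proof.
rewrite /blocks -map_drop drop_iota add0n; apply/flatten_mapP/andP => [[d]|[lt_i le_r]].
  by rewrite mem_iota mem_cls => /andP[le_d _] /andP[-> /eqP->].
exists (nth 0 w (i - c)); last by rewrite mem_cls lt_i eqxx.
have lt_s : i - c < size w by lia.
have lt_d : nth 0 w (i - c) < nb w by apply/ltn_nb/mem_nth.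
by rewrite mem_iota le_r subnKC // ltnW // (leq_ltn_trans le_r).
Qed.

(** The blocks of index at least [r] fill the positions from [s] on, so those are exactly the
    positions of letters at least [r]. The letter [r] occurs, so the suffix is nonempty. *)
Lemma tail_ok_cut c w r : rgf w -> r < nb w -> tail_ok (blocks c w) r ->
  exists a b, [/\ w = a ++ b, nb a <= r, all (leq r) b & b != [::]].
Proof.
move=> rg_w lt_r; rewrite /tail_ok sort_flatten_blocks size_iota.
set U := flatten _; set s := _ - _ => /perm_mem U_iota.
have memU k : k < size w -> (r <= nth 0 w k) = (s <= k).
  move=> lt_k; have := U_iota (c + k).
  rewrite mem_flatten_drop_blocks drop_iota mem_iota addKn => E.
  by move: E; case: (r <= _); lia.
exists (take s w), (drop s w); rewrite cat_take_drop; split=> //.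
- apply/nb_leP => d /(nthP 0)[k]; rewrite size_take_min => lt_k <-.
  rewrite nth_take; last by lia.
  by rewrite ltnNge memU; lia.
- apply/(all_nthP 0) => k; rewrite size_drop => lt_k.
  by rewrite nth_drop memU; lia.
rewrite -size_gt0 size_drop subn_gt0.
have wr := rgf_mem _ _ rg_w lt_r.
have lt_i: index r w < size w by rewrite index_mem.
by apply: leq_ltn_trans lt_i; rewrite -memU ?nth_index ?index_mem.
Qed.

Lemma last_filter_iota (P : pred nat) N r : r < N -> P r ->
  (forall k, r < k < N -> ~~ P k) -> last 0 [seq k <- iota 0 N | P k] = r.
Proof.
move=> lt_r Pr nP; rewrite -(subnKC lt_r) iotaD filter_cat.
rewrite [X in _ ++ X](eq_in_filter (a2 := pred0)) => [|k].
  by rewrite filter_pred0 cats0 -addn1 iotaD filter_cat /= Pr last_cat.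
by rewrite mem_iota => lt_k; apply/negbTE/nP; lia.
Qed.

Lemma head_filter_sorted (P : pred nat) (D : seq nat) i : sorted ltn D -> i \in D -> P i ->
  (forall k, k \in D -> k < i -> ~~ P k) -> head 0 [seq k <- D | P k] = i.
Proof.
elim: D => // k D IH sD; rewrite inE => iD Pi nP /=.
case: eqVneq iD => [<- _|ne_i /= iD]; first by rewrite Pi.
have lt_k: k < i by apply: (allP (order_path_min ltn_trans sD)).
rewrite (negPf (nP k _ lt_k)) ?mem_head //; apply: IH => // [|l lD].
  exact: path_sorted sD.
by apply: nP; rewrite inE lD orbT.
Qed.

(** The index [nb x] qualifies, as [y] fills the last blocks. A larger one would give a cut at a
    level above [nb x], hence slash [y]. *)
Lemma Rpart_blocks c x y :
    rgf x -> rgf y -> y != [::] -> ~~ wslashable y ->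
  Rpart (blocks c (wslash x y)) = blocks (c + size x) y.
Proof.
move=> rg_x rg_y y0 at_y; have sz w : size (blocks c w) = nb w.
  by rewrite size_map size_iota.
have drop_x: drop (nb x) (blocks c (wslash x y)) = blocks (c + size x) y.
  by rewrite blocks_wslash drop_size_cat.
rewrite /Rpart (last_filter_iota _ _ (nb x)) //.
- by rewrite sz nb_wslash -{1}[nb x]addn0 ltn_add2l nb_gt0.
- rewrite /tail_ok drop_x sort_flatten_blocks (perm_size (perm_flatten_blocks _ _)).
  rewrite !size_iota size_cat size_map addnK drop_iota addKn.
  exact: perm_flatten_blocks.
move=> r; rewrite sz => /andP[lt_xr lt_r]; apply: contra at_y.
have rg_xy : rgf (wslash x y) by rewrite rgf_wslash rg_x.
case/(tail_ok_cut _ _ _ rg_xy lt_r)=> a [b [Dab le_a ge_b b0]].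
exact: slash_later_cut y0 rg_y b0 lt_xr le_a ge_b Dab.
Qed.

(** The first valid [i] comes just after [u], and [j] is then the start of [y], which forms R of
    [x | y]. *)
Lemma phi_blocks u x y :
    u != [::] -> rgf u -> ~~ wsplitable u -> rgf x ->
    y != [::] -> rgf y -> ~~ wslashable y ->
  phi (size (u ++ wslash x y)) (blocks 1 (u ++ wslash x y)) = blocks 1 (wslash (u ++ x) y).
Proof.
move=> u0 rg_u uns_u rg_x y0 rg_y at_y; set v := wslash x y.
have rg_v : rgf v by rewrite rgf_wslash rg_x.
have v0 : v != [::] by rewrite /v; case: (x) => //; case: (y) y0.
have rg_w : rgf (u ++ v) by apply: rgf_cat.
have v_0 : nth 0 v 0 = 0 by case: (v) rg_v v0 => // d v' /rgf_cons0->.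
have B1 : head [::] (blocks 1 (u ++ v)) = cls 1 (u ++ v) 0.
  by have: 0 < nb (u ++ v) by [apply: nb_gt0; case: (u) u0]; rewrite /blocks; case: (nb _).
have Di : head 0 [seq i <- head [::] (blocks 1 (u ++ v)) |
   (2 <= i) && split_at (size (u ++ v)) (blocks 1 (u ++ v)) i] = (size u).+1.
  rewrite B1; apply: head_filter_sorted; first exact: cls_sorted.
  (* The element after [u] lies in the first block because [v] begins with 0. *)
  - rewrite mem_cls subSS subn0 nth_cat ltnn subnn v_0 eqxx andbT size_cat.
    by rewrite -size_gt0 in v0; lia.
  - by rewrite split_at_blocks // rg_v andbT ltnS size_gt0.
  (* An earlier valid [k] would leave a restricted growth suffix of [u]; with [2 <= k] the prefix of
     size [k.-1] is nonempty, so [u] would split. *)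
  move=> k _ lt_k; apply/negP => /andP[gt_k].
  have lt_k1: k.-1 < size u by lia.
  have Dk : k = (size (take k.-1 u)).+1 by rewrite size_takel; lia.
  have := split_at_blocks (take k.-1 u) (drop k.-1 u ++ v).
  rewrite catA cat_take_drop -Dk => -> //; last by case: (drop _ _).
  move/rgf_prefix => rg_t; case/negP: uns_u; apply/wsplitableP.
  exists (take k.-1 u), (drop k.-1 u); rewrite cat_take_drop -!size_gt0.
  by rewrite size_drop (size_takel (ltnW lt_k1)); split=> //; lia.
(* In the source [y] is raised by [nb x] only; in the image it will be raised by [nb (u ++ x)]. *)
have Dx : u ++ v = (u ++ x) ++ map (addn (nb x)) y by rewrite -catA.
have szx : size u + size x = size (u ++ x) by rewrite size_cat.
rewrite /phi Di; have -> : restrict (segment (size u).+1 (size (u ++ v))) (blocks 1 (u ++ v))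
    = blocks (1 + size u) v.
  have := restrict_blocks_suffix 1 0 u v rg_v v0.
  by rewrite map_id size_cat segmentS.
rewrite Rpart_blocks // sort_flatten_blocks.
have -> : head 0 (iota (1 + size u + size x) (size y)) = (size (u ++ x)).+1.
  by rewrite -szx; case: (y) y0.
rewrite /= segment1 Dx restrict_blocks_prefix ?rgf_cat //.
rewrite (size_cat (u ++ x)) size_map segmentS (restrict_blocks_suffix 1) //.
by rewrite unshiftp_blocks slash_blocks.
Qed.

(** * Factoring atomic splitable partitions, and bijectivity *)

Lemma atomic_splitable_factor n p :
    is_setpart n p -> atomic n p -> splitable n p ->
  exists u x y, [/\ u != [::], rgf u & ~~ wsplitable u] /\
    [/\ rgf x, y != [::], rgf y, ~~ wslashable y & nb x < nb u] /\
    [/\ p = blocks 1 (u ++ wslash x y), size (u ++ wslash x y) = n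
      & phi n p = blocks 1 (wslash (u ++ x) y)].
Proof.
case/blocks_of_part=> w [rg_w sz_w Dp].
rewrite Dp => /(atomic_blocks n w rg_w) at_w /(splitable_blocks n w rg_w) sp_w.
have w0 : w != [::] by case: (w) sp_w.
have [u [v [u0 rg_u rg_v uns_u Dw]]] := split_factor w w0 rg_w.
have v0 : v != [::].
  by apply: contraNneq uns_u => v0; rewrite Dw v0 cats0 in sp_w.
have [x [y [y0 rg_x rg_y at_y Dv]]] := slash_factor v v0 rg_v.
exists u, x, y; split=> //; rewrite Dw Dv in at_w sz_w *; split; split=> //.
  exact: nb_lt_of_atomic at_w.
by rewrite -sz_w phi_blocks.
Qed.

Theorem mainTheorem1 (n : nat) (hn : 1 <= n) :
  let inA p := [/\ is_setpart n p, atomic n p & splitable n p] in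
  let inB q := [/\ is_setpart n q, ~ splitable n q & ~ atomic n q] in
  [/\ (forall p, inA p -> inB (phi n p)),
      (forall p p', inA p -> inA p' -> phi n p = phi n p' -> p = p')
    & (forall q, inB q -> exists2 p, inA p & phi n p = q)].
Proof.
have nil_l u v : u != [::] -> u ++ v != [::] by case: u.
have nil_w u v : v != [::] -> wslash u v != [::] by case: u => //; case: v.
have sz u x y : size (wslash (u ++ x) y) = size (u ++ wslash x y).
  by rewrite !size_cat !size_map addnA.
move=> inA inB; split=> [p|p p'|q].
- case=> set_p at_p sp_p.
  have [u [x [y [[u0 rg_u uns_u] [[rg_x y0 rg_y at_y lt_x] [_ sz_w ->]]]]]] :=
    atomic_splitable_factor n p set_p at_p sp_p.
  have rg_q : rgf (wslash (u ++ x) y) by rewrite rgf_wslash rgf_cat.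
  split; first by rewrite /is_setpart -sz_w -sz; apply: blocks_part.
    by move/(splitable_blocks n _ rg_q); apply/negP/wslash_unsplitable.
  move/(atomic_blocks n _ rg_q)/negP; apply; apply/(wslashableP _ rg_q).
  by exists (u ++ x), y; rewrite rgf_cat // nil_l.
- case=> set_p at_p sp_p [set_p' at_p' sp_p'].
  have [u [x [y [[u0 _ uns_u] [[rg_x y0 rg_y at_y _] [-> _ ->]]]]]] :=
    atomic_splitable_factor n p set_p at_p sp_p.
  have [u' [x' [y' [[u0' _ uns_u'] [[rg_x' y0' rg_y' at_y' _] [-> _ ->]]]]]] :=
    atomic_splitable_factor n p' set_p' at_p' sp_p'.
  (* Unique slash factorisation recovers [y] and [u ++ x]; unique split factorisation then separates
     [u] from [x]. *)
  move/blocks_inj/(slash_factor_uniq _ _ _ _ y0 y0' rg_y rg_y' at_y at_y')=> -[E <-].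
  by have [<- <-] := split_factor_uniq _ _ _ _ u0 u0' rg_x rg_x' uns_u uns_u' E.
case=> /blocks_of_part[w [rg_w sz_w ->]] nsp_w nat_w.
have uns_w : ~~ wsplitable w by apply/negP => /(splitable_blocks n w rg_w).
have sl_w : wslashable w.
  by case: (boolP (wslashable w)) => // /(atomic_blocks n w rg_w).
have w0 : w != [::] by case: (w) sl_w.
(* The preimage is found by factoring in the reverse order: first [w = z | y], then [z = u ++ x]. *)
have [z [y [y0 rg_z rg_y at_y Dw]]] := slash_factor w w0 rg_w.
(* Otherwise [w] would be the atomic word [y]. *)
have z0 : z != [::].
  by apply: contraTneq sl_w => z0; rewrite Dw z0 /wslash map_id.
have [u [x [u0 rg_u rg_x uns_u Dz]]] := split_factor z z0 rg_z.
rewrite Dw Dz in uns_w sz_w *.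
have lt_x := nb_lt_of_unsplitable u x y u0 rg_x rg_y y0 uns_w.
have rg_p : rgf (u ++ wslash x y) by rewrite rgf_cat ?rgf_wslash ?rg_x.
exists (blocks 1 (u ++ wslash x y)); last by rewrite -sz_w sz phi_blocks.
split; first by rewrite /is_setpart -sz_w sz; apply: blocks_part.
  exact/(atomic_blocks n _ rg_p)/unslash_atomic.
apply/(splitable_blocks n _ rg_p)/wsplitableP; exists u, (wslash x y).
by rewrite rgf_wslash rg_x nil_w.
Qed.
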